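(* Let $q$ be a prime power, $n\ge2$, $E=\mathbb{F}_q^n$, and $1\le k\le n-1$. Let $\mathcal{S}_1,\mathcal{S}_2$ be collections of $k$-dimensional subspaces of $E$ such that, for $i=1,2$, $\dim(V\cap W)\le k-2$ for all distinct $V,W\in\mathcal{S}_i$, and assume $\mathcal{S}_1\cap\mathcal{S}_2=\emptyset$. Let $\mathcal{M}_i$ be the paving $q$-matroid induced by $\mathcal{S}_i$ ($i=1,2$), let $\lambda\in\mathbb{Q}$ with $0<\lambda<1$, and let $\mathcal{M}=\lambda\mathcal{M}_1+(1-\lambda)\mathcal{M}_2$. Then the collection of cyclic spaces of $\mathcal{M}$ is $$\mathcal{O}_{\mathcal{M}}=\mathcal{S}_1\cup\mathcal{S}_2\cup\{\langle 0\rangle\}\cup\mathcal{L}(E)_{\ge k+1}.$$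
   Context: $\mathcal{L}(E)$ is the lattice of subspaces of $E$ and $\mathcal{L}(E)_{\ge i}$ the set of subspaces of dimension at least $i$. A $q$-polymatroid is $(\mathcal{L}(E),\rho)$ with $\rho:\mathcal{L}(E)\to\mathbb{R}$ satisfying $0\le\rho(A)\le\dim A$, monotonicity, and submodularity; a $q$-matroid if $\rho$ is integer-valued. The paving $q$-matroid induced by $\mathcal{S}$ has rank function $\rho_{\mathcal{S}}(V)=k-1$ if $V\in\mathcal{S}$ and $\min\{\dim V,k\}$ otherwise. The convex combination $\lambda\mathcal{M}_1+(1-\lambda)\mathcal{M}_2$ has rank function $\lambda\rho_1+(1-\lambda)\rho_2$. A subspace $X$ is cyclic in a $q$-polymatroid with rank function $\rho$ if for every codimension-one subspace $H$ of $X$ either (1) $\rho(X)=\rho(H)$, or (2) $0<\rho(X)-\rho(H)$ and there is a one-dimensional $a\le X$ with $a\not\le H$ such that $\rho(X)-\rho(H)<\rho(a)$.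
   Formalization: For k = 1 the formal theorem additionally assumes that S_1 ∪ S_2 is empty; otherwise the claim fails, since a line V in exactly one S_i has rank strictly between 0 and 1, equal to that of its only line, and so is not cyclic. *)

(* Defs.v *)
From HB Require Import structures.
From mathcomp Require Import all_boot all_order all_algebra.
From mathcomp Require Import boolp classical_sets reals.
From mathcomp Require Import zify lra.

Set Implicit Arguments.
Unset Strict Implicit.
Unset Printing Implicit Defensive.

Import Order.TTheory GRing.Theory Num.Theory.

Local Open Scope classical_set_scope.
Local Open Scope ring_scope.

Record qpolymatroid (R : realType) (F : finFieldType) (n : nat) := QPolymatroid {
  qrank :> {vspace 'rV[F]_n} -> R;
  qrank_bounded : forall A, 0 <= qrank A <= (\dim A)%:R;
  qrank_monotone : forall A B, (A <= B)%VS -> qrank A <= qrank B;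
  qrank_submodular : forall A B,
    qrank (A + B)%VS + qrank (A :&: B)%VS <= qrank A + qrank B
}.

Record qmatroid (R : realType) (F : finFieldType) (n : nat) := QMatroid {
  qmatroid_qpolymatroid :> qpolymatroid R F n;
  qmatroid_int : forall A, qmatroid_qpolymatroid A \is a Num.int
}.

(* "\dim (V :&: W) <= k - 2" is stated additively because subtraction on nat is
   truncated: for k = 1 it must be unsatisfiable, so that S has at most one
   element. *)
Record paving_collection (F : finFieldType) (n k : nat)
    (S : set {vspace 'rV[F]_n}) : Prop := PavingCollection {
  paving_dim : forall V, S V -> \dim V = k :> nat;
  paving_cap : forall V W, S V -> S W -> V <> W ->
    (\dim (V :&: W) + 2 <= k)%N
}.

Definition paving_rank (F : finFieldType) (n k : nat)
    (S : set {vspace 'rV[F]_n}) (V : {vspace 'rV[F]_n}) : nat :=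
  if V \in S then (k - 1)%N else minn (\dim V) k.

Section PavingRank.
Variables (F : finFieldType) (n k : nat) (S : set {vspace 'rV[F]_n}).
Hypotheses (k_gt0 : (1 <= k)%N) (pS : paving_collection k S).
Implicit Types A B : {vspace 'rV[F]_n}.
Local Notation rk := (paving_rank k S).

Variant paving_rank_spec A : nat -> Type :=
| PavingIn of S A & \dim A = k :> nat : paving_rank_spec A (k - 1)%N
| PavingOut r of ~ S A & (r <= \dim A)%N & (r <= k)%N
    & (\dim A <= r)%N || (k <= r)%N : paving_rank_spec A r.

Lemma paving_rankP A : paving_rank_spec A (rk A).
Proof.
rewrite /paving_rank; case: ifPn => [/set_mem SA|/negP nSA].
  by constructor=> //; exact: paving_dim pS _ SA.
constructor; rewrite ?geq_minl ?geq_minr //; first by move=> /mem_set.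
by rewrite !leq_min !leqnn andbT /= leq_total.
Qed.

Lemma paving_rank_le_dim A : (rk A <= \dim A)%N.
Proof. by case: paving_rankP => *; lia. Qed.

Lemma paving_rank_le_k A : (rk A <= k)%N.
Proof. by case: paving_rankP => *; lia. Qed.

Lemma paving_rank_monotone A B : (A <= B)%VS -> (rk A <= rk B)%N.
Proof.
move=> sAB; have dAB := dimvS sAB.
case: (eqVneq A B) => [->//|neAB].
have ltAB : ~~ (\dim B <= \dim A)%N.
  by apply: contra neAB => dBA; rewrite eqEdim sAB.
have := paving_rank_le_dim A; have := paving_rank_le_k A.
by case: (paving_rankP B) => *; lia.
Qed.

Lemma paving_rank_submodular A B :
  (rk (A + B)%VS + rk (A :&: B)%VS <= rk A + rk B)%N.
Proof.
case: (boolP (A <= B)%VS) => [sAB|nAB].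
  by rewrite (addv_idPr sAB) (capv_idPl sAB) addnC.
case: (boolP (B <= A)%VS) => [sBA|nBA].
  by rewrite (addv_idPl sBA) (capv_idPr sBA).
have d1 : (\dim (A :&: B) < \dim A)%N.
  rewrite ltn_neqAle (dimvS (capvSl A B)) andbT.
  by rewrite (dimv_leqif_eq (capvSl A B)); apply: contra nAB => /eqP/capv_idPl.
have d2 : (\dim (A :&: B) < \dim B)%N.
  rewrite ltn_neqAle (dimvS (capvSr A B)) andbT.
  by rewrite (dimv_leqif_eq (capvSr A B)); apply: contra nBA => /eqP/capv_idPr.
have d3 := dimv_sum_cap A B.
have r1 := paving_rank_le_k (A + B)%VS.
have r1' := paving_rank_le_dim (A + B)%VS.
have r2 := paving_rank_le_k (A :&: B)%VS.
have r2' := paving_rank_le_dim (A :&: B)%VS.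
case: (paving_rankP A) => [SA dA|nSA]; case: (paving_rankP B) => [SB dB|nSB];
  try lia.
have neAB : A <> B by move=> eAB; rewrite eAB subvv in nAB.
by have := paving_cap pS SA SB neAB; lia.
Qed.

End PavingRank.

Section PavingQMatroid.
Variables (R : realType) (F : finFieldType) (n k : nat).
Variable S : set {vspace 'rV[F]_n}.
Hypotheses (k_gt0 : (1 <= k)%N) (pS : paving_collection k S).

Local Notation rho :=
  (fun V : {vspace 'rV[F]_n} => (paving_rank k S V)%:R : R).

Fact paving_bounded A : 0 <= rho A <= (\dim A)%:R.
Proof. by rewrite ler0n ler_nat (paving_rank_le_dim k_gt0 pS). Qed.

Fact paving_monotone A B : (A <= B)%VS -> rho A <= rho B.
Proof. by move=> sAB; rewrite ler_nat (paving_rank_monotone k_gt0 pS). Qed.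

Fact paving_submodular A B :
  rho (A + B)%VS + rho (A :&: B)%VS <= rho A + rho B.
Proof. by rewrite -!natrD ler_nat (paving_rank_submodular k_gt0 pS). Qed.

Definition paving_qpolymatroid : qpolymatroid R F n :=
  @QPolymatroid R F n rho
    paving_bounded paving_monotone paving_submodular.

Fact paving_int A : paving_qpolymatroid A \is a Num.int.
Proof. exact: rpred_nat. Qed.

Definition paving_qmatroid : qmatroid R F n := QMatroid paving_int.

End PavingQMatroid.

Section ConvexCombination.
Variables (R : realType) (F : finFieldType) (n : nat) (lambda : rat).
Hypothesis lambda01 : 0 < lambda < 1.
Variables M1 M2 : qpolymatroid R F n.

Definition convex_comb_rank (V : {vspace 'rV[F]_n}) : R :=
  ratr lambda * M1 V + (1 - ratr lambda) * M2 V.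
Local Notation rho := convex_comb_rank.

Fact ratr_lambda01 : (0 : R) < ratr lambda < (1 : R).
Proof. by rewrite ltr0q -[X in _ && (_ < X)](rmorph1 (@ratr R)) ltr_rat. Qed.

Fact convex_comb_bounded A : 0 <= rho A <= (\dim A)%:R.
Proof.
have := ratr_lambda01; have := qrank_bounded M1 A; have := qrank_bounded M2 A.
rewrite /convex_comb_rank; nra.
Qed.

Fact convex_comb_monotone A B : (A <= B)%VS -> rho A <= rho B.
Proof.
move=> sAB; have := ratr_lambda01.
have := qrank_monotone M1 sAB; have := qrank_monotone M2 sAB.
rewrite /convex_comb_rank; nra.
Qed.

Fact convex_comb_submodular A B :
  rho (A + B)%VS + rho (A :&: B)%VS <= rho A + rho B.
Proof.
have := ratr_lambda01.
have := qrank_submodular M1 A B; have := qrank_submodular M2 A B.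
rewrite /convex_comb_rank; nra.
Qed.

Definition convex_comb : qpolymatroid R F n :=
  @QPolymatroid R F n rho
    convex_comb_bounded convex_comb_monotone convex_comb_submodular.

End ConvexCombination.

Definition cyclic_space (R : realType) (F : finFieldType) (n : nat)
    (M : qpolymatroid R F n) (X : {vspace 'rV[F]_n}) : Prop :=
  forall H : {vspace 'rV[F]_n}, (H <= X)%VS -> \dim X = (\dim H + 1)%N :> nat ->
    M X = M H \/
    (0 < M X - M H /\
     exists a : {vspace 'rV[F]_n},
       [/\ \dim a = 1%N :> nat, (a <= X)%VS, ~ (a <= H)%VS & M X - M H < M a]).

Definition cyclic_spaces (R : realType) (F : finFieldType) (n : nat)
    (M : qpolymatroid R F n) : set {vspace 'rV[F]_n} :=
  [set X | cyclic_space M X].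

Definition subspaces_ge (F : finFieldType) (n i : nat) :
    set {vspace 'rV[F]_n} :=
  [set V | (i <= \dim V)%N].

(* Main.v *)
(** In [M] every line has rank 1: for [k >= 2] lines have dimension below [k],
    and for [k = 1] the collections are empty.  Hence a space [X] is cyclic
    exactly when [M X - M H < 1] for each of its hyperplanes [H].  This
    difference is [1] when [X] and [H] are both independent, and it is [0] or
    one of the weights [lambda], [1 - lambda] as soon as [X] is dependent. *)
Require Import Defs.
From mathcomp Require Import all_boot all_order all_algebra.
From mathcomp Require Import boolp classical_sets reals.
From mathcomp Require Import zify lra.

Import Order.TTheory GRing.Theory Num.Theory.

Local Open Scope classical_set_scope.
Local Open Scope ring_scope.

(** [vpick X] is a nonzero vector of [X] when [X] is nonzero, so a complement in [X] of the line it
    spans has codimension one. *)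
Lemma exists_hyperplane (K : fieldType) (vT : vectType K) (X : {vspace vT}) :
  X <> 0%VS -> exists2 H : {vspace vT}, (H <= X)%VS & \dim X = (\dim H + 1)%N.
Proof.
move=> X0; exists (X :\: <[vpick X]>)%VS; first exact: diffvSl.
rewrite -(dimv_cap_compl X <[vpick X]>) (capv_idPr _); last first.
  by rewrite -memvE memv_pick.
by rewrite dim_vline vpick0 addnC; case: eqP X0.
Qed.

Lemma exists_line_notin (K : fieldType) (vT : vectType K)
    (X H : {vspace vT}) :
  ~ (X <= H)%VS ->
  exists a : {vspace vT}, [/\ \dim a = 1%N, (a <= X)%VS & ~ (a <= H)%VS].
Proof.
move=> /negP/subvPn[v vX vH]; exists <[v]>%VS; split.
- by rewrite dim_vline; case: eqP vH => // ->; rewrite mem0v.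
- by rewrite -memvE.
- by rewrite -memvE; apply/negP.
Qed.

(** With all lines of rank 1, the bound in clause (2) no longer depends on the choice of [a], and a
    line of [X] outside [H] exists because [H] is smaller than [X]. Clause (1) is the case of
    difference 0. *)
Lemma cyclic_space_unit_lines (R : realType) (F : finFieldType) (n : nat)
    (M : qpolymatroid R F n) (X : {vspace 'rV[F]_n}) :
  (forall a : {vspace 'rV[F]_n}, \dim a = 1%N -> M a = 1) ->
  cyclic_space M X <->
  forall H : {vspace 'rV[F]_n},
    (H <= X)%VS -> \dim X = (\dim H + 1)%N -> M X - M H < 1.
Proof.
move=> M1; split=> [cX H sHX dX | ltX H sHX dX].
  have [->|[_ [a [da _ _]]]] := cX H sHX dX; first by rewrite subrr ltr01.
  by rewrite (M1 a).
have := qrank_monotone M sHX; rewrite le_eqVlt => /orP[/eqP->|ltHX].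
  by left.
right; split; first by rewrite subr_gt0.
have [|a [da aX aH]] := @exists_line_notin _ _ X H.
  by move=> /dimvS; lia.
by exists a; split=> //; rewrite (M1 a) // ltX.
Qed.

Section ConvexPaving.
Variables (R : realType) (F : finFieldType) (n k : nat) (k_ge1 : (1 <= k)%N).
Variables S1 S2 : set {vspace 'rV[F]_n}.
Hypotheses (pS1 : paving_collection k S1) (pS2 : paving_collection k S2).
Variables (lambda : rat) (lambda01 : 0 < lambda < 1).
Implicit Types V : {vspace 'rV[F]_n}.

Local Notation M := (convex_comb lambda01 (paving_qmatroid R k_ge1 pS1)
                                          (paving_qmatroid R k_ge1 pS2)).

(** Membership in a collection lowers the corresponding paving rank from [k] to [k - 1], so it costs
    exactly the weight of that matroid. *)
Lemma convex_pavingE V :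
  M V = (minn (\dim V) k)%:R - ratr lambda * (V \in S1)%:R
        - (1 - ratr lambda) * (V \in S2)%:R.
Proof.
have rkE (S : set {vspace 'rV[F]_n}) : paving_collection k S ->
    (paving_rank k S V)%:R = (minn (\dim V) k)%:R - (V \in S)%:R :> R.
  move=> pS; rewrite /paving_rank; case: ifPn => [/set_mem SV|_].
    (* The truncated [k - 1] is a true difference because [1 <= k]. *)
    by rewrite (paving_dim pS SV) minnn natrB.
  by rewrite subr0.
by rewrite /= /convex_comb_rank /= !rkE //; lra.
Qed.

Lemma convex_paving_out V : ~ S1 V -> ~ S2 V -> M V = (minn (\dim V) k)%:R.
Proof.
by move=> V1 V2; rewrite convex_pavingE !memNset // !mulr0 !subr0.
Qed.

Lemma convex_paving_dim_neq V : \dim V <> k -> M V = (minn (\dim V) k)%:R.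
Proof.
move=> dV; apply: convex_paving_out => SV; apply: dV.
  exact: paving_dim pS1 _ SV.
exact: paving_dim pS2 _ SV.
Qed.

(** Disjointness makes [V] lose exactly one of the two weights, and each lies strictly between 0 and
    1. *)
Lemma convex_paving_in V :
  S1 `&` S2 = set0 -> (S1 `|` S2) V -> k%:R - 1 < M V < k%:R.
Proof.
move=> S12 SV; have := ratr_lambda01 R lambda01.
have V12 : ~ (S1 V /\ S2 V) by move=> V12; have : (S1 `&` S2) V by []; rewrite S12.
have dV : \dim V = k by case: SV => [/(paving_dim pS1)|/(paving_dim pS2)].
rewrite convex_pavingE dV minnn; case: SV => [V1|V2].
  by rewrite (mem_set V1) memNset => [|V2]; [rewrite mulr1 mulr0; lra | apply: V12].
by rewrite (mem_set V2) memNset => [|V1]; [rewrite mulr1 mulr0; lra | apply: V12].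
Qed.

End ConvexPaving.

Theorem theorem5p11 (R : realType) (F : finFieldType) (n k : nat)
    (n_ge2 : (2 <= n)%N) (k_ge1 : (1 <= k)%N) (k_le : (k <= n - 1)%N)
    (S1 S2 : set {vspace 'rV[F]_n})
    (pS1 : paving_collection k S1) (pS2 : paving_collection k S2)
    (S12 : S1 `&` S2 = set0)
    (* Not in the source, but necessary: for k = 1 a line V in exactly one S_i
       has rank strictly between 0 and 1 and is not cyclic. *)
    (k1_degenerate : k = 1%N -> S1 `|` S2 = set0)
    (lambda : rat) (lambda01 : 0 < lambda < 1) :
  cyclic_spaces
    (convex_comb lambda01 (paving_qmatroid R k_ge1 pS1)
                          (paving_qmatroid R k_ge1 pS2))
  = S1 `|` S2 `|` [set 0%VS] `|` @subspaces_ge F n (k + 1).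
Proof.
set M := convex_comb _ _ _.
have dimS V : (S1 `|` S2) V -> \dim V = k.
  by move=> [/(paving_dim pS1)|/(paving_dim pS2)].
have Mout V : ~ (S1 `|` S2) V -> M V = (minn (\dim V) k)%:R.
  by move=> SV; apply: convex_paving_out => ?; apply: SV; [left | right].
have Mdim V : \dim V <> k -> M V = (minn (\dim V) k)%:R.
  exact: convex_paving_dim_neq.
have Min V : (S1 `|` S2) V -> k%:R - 1 < M V < k%:R.
  exact: convex_paving_in.
have Mline a : \dim a = 1%N -> M a = 1.
  move=> da; rewrite Mout ?da ?(minn_idPl k_ge1) // => Sa.
  by have := Sa; rewrite k1_degenerate // -(dimS _ Sa).
apply/seteqP; split=> X; rewrite /cyclic_spaces /subspaces_ge /=.
  move=> /(cyclic_space_unit_lines _ _ _ _ _ Mline) cX.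
  have [SX|SX] := pselect ((S1 `|` S2) X); first by left; left.
  have [X0|X0] := pselect (X = 0%VS); first by left; right.
  (* If [\dim X <= k], then [X] and any hyperplane of it have rank equal to their dimension, so the
     difference is exactly 1. *)
  right; rewrite addn1 ltnNge; apply/negP => dXk.
  have [H sHX dX] := exists_hyperplane _ _ _ X0.
  have := cX H sHX dX; rewrite Mout // Mdim; last by lia.
  rewrite (minn_idPl dXk) (minn_idPl _); last by lia.
  by rewrite dX natrD addrC addKr ltxx.
move=> inX; apply/(cyclic_space_unit_lines _ _ _ _ _ Mline) => H sHX dX.
case: inX => [[SX|X0]|dXk].
(* Here [H] has dimension and rank [k - 1], while [X] has rank below [k]. *)
- have dXk := dimS _ SX; have /andP[_ ltX] := Min _ SX.
  rewrite (Mdim H); last by lia.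
  rewrite (minn_idPl _); last by lia.
  by rewrite ltrBlDl natr1 -addn1 -dX dXk.
(* The zero space has no hyperplane, so the condition is vacuous. *)
- by move: dX; rewrite X0 dimv0 addn1.
(* Now [X] has rank [k] and [\dim H >= k], so [H] has rank [k], or above [k - 1] if it lies in a
   collection. *)
- rewrite (Mdim X); last by lia.
  rewrite (minn_idPr _); last by lia.
  have [SH|SH] := pselect ((S1 `|` S2) H).
    by have /andP[ltH _] := Min _ SH; lra.
  by rewrite Mout // (minn_idPr _) ?subrr ?ltr01 //; lia.
Qed.
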